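(* If $K\in\mathcal{K}_0^n$ then $\Phi(K)$ is convex if and only if $K^{\circ}\in\mathcal{R}^n$.
   Context: A convex body in $\mathbb{R}^n$ is a closed convex set $K\subseteq\mathbb{R}^n$ with $0\in K$ (not assumed compact, nor with non-empty interior); $\mathcal{K}_0^n$ is the set of all convex bodies. The support function of $K$ is $h_K:S^{n-1}\to[0,\infty]$, $h_K(\theta)=\sup_{x\in K}\langle x,\theta\rangle$, and $K^\circ=\{y\in\mathbb{R}^n:\langle x,y\rangle\le 1\text{ for all }x\in K\}$. A star set is a non-empty $A\subseteq\mathbb{R}^n$ such that $x\in A$ and $0\le\lambda\le1$ imply $\lambda x\in A$; its radial function is $r_A:S^{n-1}\to[0,\infty]$, $r_A(\theta)=\sup\{\lambda\ge0:\lambda\theta\in A\}$. A star body is a star set $A$ with $r_A(\theta)\theta\in A$ for all $\theta\in S^{n-1}$ with $r_A(\theta)<\infty$; it is uniquely determined by $r_A$. For a star body $A$, $\Phi(A)$ is the star body with radial function $r_{\Phi(A)}=1/r_A$ ($1/0=\infty$, $1/\infty=0$). For $g:S^{n-1}\to[0,\infty]$, $A[g]=\{x\in\mathbb{R}^n:\langle x,\theta\rangle\le g(\theta)\text{ for all }\theta\in S^{n-1}\}$. The reciprocal body of $K\in\mathcal{K}_0^n$ is $K'=A[1/h_K]\in\mathcal{K}_0^n$. $\mathcal{R}^n=\{K':K\in\mathcal{K}_0^n\}$ is the class of reciprocal bodies. *)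

(* Defs.v *)
From HB Require Import structures.
From mathcomp Require Import all_boot all_order all_algebra.
From mathcomp Require Import all_classical all_reals all_analysis.

Set Implicit Arguments.
Unset Strict Implicit.
Unset Printing Implicit Defensive.

Import Order.TTheory GRing.Theory Num.Theory.
Import numFieldNormedType.Exports.

Local Open Scope classical_set_scope.
Local Open Scope ring_scope.
Local Open Scope ereal_scope.

Section Definitions.
Context {R : realType} {n : nat}.
Local Notation V := 'rV[R]_n.
Implicit Types (A K L : set V) (x y theta : V) (g : V -> \bar R).

Definition dot x y : R := (\sum_(i < n) x ord0 i * y ord0 i)%R.

(* The Euclidean unit sphere; the library norm on row vectors is the sup norm. *)
Definition sphere : set V := [set theta | dot theta theta = 1%R].

(* The topology on row vectors is the product one, i.e. the Euclidean one. *)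
Definition convex_body K : Prop :=
  [/\ closed K, convex_set (K : set (convex_lmodType V)) & K 0%R].

(* Functions on the sphere are encoded as total functions on the whole space;
   only their values on [sphere] are ever used. *)
Definition support_fun K : V -> \bar R :=
  fun theta => ereal_sup [set (dot x theta)%:E | x in K].

Definition polar K : set V := [set y | forall x, K x -> (dot x y <= 1)%R].

Definition star_set A : Prop :=
  A !=set0 /\
  forall x (l : R), A x -> (0 <= l <= 1)%R -> A (l *: x)%R.

Definition radial_fun A : V -> \bar R :=
  fun theta =>
    ereal_sup [set l%:E | l in [set l : R | (0 <= l)%R /\ A (l *: theta)%R]].

Definition star_body A : Prop :=
  star_set A /\
  forall theta, sphere theta -> radial_fun A theta < +oo ->
    A (fine (radial_fun A theta) *: theta)%R.

(* The star body with radial function g, for g nonnegative on the sphere; see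
   [star_body_of_radial], [radial_star_body_of] and [star_body_inj]. The origin
   is added separately for the sake of the case n = 0, where the sphere is
   empty. *)
Definition star_body_of g : set V :=
  0%R |` [set x | exists theta (l : R),
            [/\ sphere theta, (0 <= l)%R, l%:E <= g theta & x = (l *: theta)%R]].

(* The inverse on \bar R satisfies 0^-1 = +oo and +oo^-1 = 0 (inve0, invey). *)
Definition Phi A : set V := star_body_of (fun theta => (radial_fun A theta)^-1).

(* The Wulff shape A[g] of g. *)
Definition wulff g : set V :=
  [set x | forall theta, sphere theta -> (dot x theta)%:E <= g theta].

Definition reciprocal K : set V := wulff (fun theta => (support_fun K theta)^-1).

Definition reciprocal_bodies : set (set V) := reciprocal @` convex_body.

End Definitions.

Arguments sphere : clear implicits.
Arguments reciprocal_bodies : clear implicits.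

Section Facts.
Context {R : realType} {n : nat}.
Local Notation V := 'rV[R]_n.
Implicit Types (A B K : set V) (x theta : V) (g : V -> \bar R).

Lemma dotZ (a b : R) x y : dot (a *: x)%R (b *: y : V)%R = (a * b * dot x y)%R.
Proof.
rewrite /dot big_distrr; apply: eq_bigr => i _.
by rewrite !mxE mulrACA.
Qed.

Lemma dot_gt0 x : x != 0%R -> (0 < dot x x)%R.
Proof.
move=> x0; have ge0 i : true -> (0 <= x ord0 i * x ord0 i)%R.
  by move=> _; rewrite -expr2 sqr_ge0.
rewrite lt_neqAle sumr_ge0 // andbT eq_sym; apply: contra x0.
rewrite psumr_eq0 // => /allP h; apply/eqP/rowP => i.
by move: (h i (mem_index_enum i)); rewrite mulf_eq0 orbb mxE => /eqP.
Qed.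

Lemma polar_decomposition x : x != 0%R ->
  exists theta (l : R), [/\ sphere R n theta, (0 < l)%R & x = (l *: theta)%R].
Proof.
move=> /dot_gt0 x0; have s0 : (0 < Num.sqrt (dot x x))%R by rewrite sqrtr_gt0.
have s0' := lt0r_neq0 s0.
exists ((Num.sqrt (dot x x))^-1 *: x)%R, (Num.sqrt (dot x x)); split => //.
  rewrite /sphere/= dotZ -invfM -expr2 sqr_sqrtr ?ltW // mulVf //.
  exact: lt0r_neq0.
by rewrite scalerA divff // scale1r.
Qed.

Lemma sphere_scale_inj theta eta (l m : R) : sphere R n theta -> sphere R n eta ->
  (0 < l)%R -> (0 <= m)%R -> (l *: theta = m *: eta)%R -> l = m /\ theta = eta.
Proof.
move=> st se l0 m0 e.
have : dot (l *: theta)%R (l *: theta)%R = dot (m *: eta)%R (m *: eta)%R.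
  by rewrite e.
rewrite !dotZ st se !mulr1 -!expr2 => /eqP.
rewrite eqrXn2 // ?(ltW l0) // => /eqP lm; split=> //.
by move: e; rewrite -lm => /(scalerI (lt0r_neq0 l0)).
Qed.

Lemma radial_ge0 A theta : A 0%R -> 0 <= radial_fun A theta.
Proof.
move=> A0; apply: ereal_sup_ubound; exists 0%R => //=.
by rewrite scale0r.
Qed.

Lemma star_set0 A : star_set A -> A 0%R.
Proof.
case=> -[x Ax] /(_ x 0%R Ax); rewrite scale0r lexx ler01; exact.
Qed.

Lemma star_body_ofE g theta (l : R) : (forall eta, sphere R n eta -> 0 <= g eta) ->
  sphere R n theta -> (0 <= l)%R ->
  star_body_of g (l *: theta)%R <-> l%:E <= g theta.
Proof.
move=> g0 st; rewrite le_eqVlt => /predU1P[<-|l0].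
  by rewrite scale0r; split=> _; [exact: g0|left].
split; last by move=> lg; right; exists theta, l; split => //; exact: ltW.
case=> [/= e|[eta [m [se m0 mg e]]]].
  have : dot (l *: theta)%R (l *: theta)%R = 0%R.
    by rewrite e /dot big1// => i _; rewrite !mxE mulr0.
  rewrite dotZ st mulr1 => /eqP; rewrite mulf_eq0 orbb => /eqP l00.
  by move: l0; rewrite l00 ltxx.
by have [-> ->] := sphere_scale_inj st se l0 m0 e.
Qed.

Lemma radial_star_body_of g theta : (forall eta, sphere R n eta -> 0 <= g eta) ->
  sphere R n theta -> radial_fun (star_body_of g) theta = g theta.
Proof.
move=> g0 st; apply/eqP; rewrite eq_le; apply/andP; split.
  apply: ge_ereal_sup => _ [l [l0 /(star_body_ofE g0 st l0) h] <-] //.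
have := g0 _ st; case E : (g theta) => [r| |] //= r0.
  apply: ereal_sup_ubound; exists r => //; split => //.
  by apply/(star_body_ofE g0 st) => //; rewrite E.
rewrite leye_eq; apply/eqP/eqyP => m m0.
apply: ereal_sup_ubound; exists m => //; split; first exact: ltW.
by apply/(star_body_ofE g0 st (ltW m0)); rewrite E leey.
Qed.

Lemma star_body_of_radial g : (forall eta, sphere R n eta -> 0 <= g eta) ->
  star_body (star_body_of g).
Proof.
move=> g0; split.
  split; first by exists 0%R; left.
  move=> x l [->|[theta [m [st m0 mg ->]]]] /andP[l0 l1].
    by rewrite scaler0; left.
  right; exists theta, (l * m)%R; split => //; rewrite ?scalerA ?mulr_ge0 //.
  by apply: le_trans mg; rewrite lee_fin ler_piMl.
move=> theta st; rewrite radial_star_body_of // => gy.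
have gf : g theta \is a fin_num by rewrite ge0_fin_numE // g0.
by apply/star_body_ofE => //; rewrite ?fineK // fine_ge0 // g0.
Qed.

Lemma star_body_radial A theta (l : R) : star_body A -> sphere R n theta ->
  (0 <= l)%R -> l%:E <= radial_fun A theta -> A (l *: theta)%R.
Proof.
move=> [sA bA] st l0 lr.
have sub (m : R) : (0 < m)%R -> (l <= m)%R -> A (m *: theta)%R -> A (l *: theta)%R.
  move=> m0 lm /(sA.2 _ (l / m)%R); rewrite scalerA divfK ?gt_eqF //; apply.
  by rewrite divr_ge0 ?(ltW m0) // ler_pdivrMr // mul1r.
move: l0; rewrite le_eqVlt => /predU1P[<-|l0].
  by rewrite scale0r; exact: star_set0.
have [ry|] := ltP (radial_fun A theta) +oo.
  have rf : radial_fun A theta \is a fin_num.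
    by rewrite ge0_fin_numE // radial_ge0 //; exact: star_set0.
  have lr' : (l <= fine (radial_fun A theta))%R by rewrite -lee_fin fineK.
  by apply: (sub _ _ lr' (bA _ st ry)); exact: lt_le_trans lr'.
rewrite leye_eq => /eqP ry.
have : l%:E < radial_fun A theta by rewrite ry ltry.
move=> /ereal_sup_gt[_ [m [m0 Am] <-]]; rewrite lte_fin => lm.
by apply: (sub m) => //; [exact: lt_trans lm|exact: ltW].
Qed.

Lemma star_body_inj A B : star_body A -> star_body B ->
  (forall theta, sphere R n theta -> radial_fun A theta = radial_fun B theta) ->
  A = B.
Proof.
have sub A' B' : star_body A' -> star_body B' ->
    (forall theta, sphere R n theta -> radial_fun A' theta = radial_fun B' theta) ->
    A' `<=` B'.
  move=> sA sB e x; have [->|x0] := eqVneq x 0%R.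
    by move=> _; exact: star_set0 sB.1.
  have [theta [l [st l0 ->]]] := polar_decomposition x0 => Ax.
  apply: star_body_radial => //; first exact: ltW.
  rewrite -e //; apply: ereal_sup_ubound; exists l => //; split => //.
  exact: ltW.
move=> sA sB e; apply/seteqP; split; first exact: sub.
by apply: sub => // theta st; rewrite e.
Qed.

Lemma Phi_star_body A : star_set A -> star_body (Phi A).
Proof.
move=> /star_set0 A0; apply: star_body_of_radial => theta _.
by rewrite inve_ge0 radial_ge0.
Qed.

Lemma radial_Phi A theta : star_set A -> sphere R n theta ->
  radial_fun (Phi A) theta = (radial_fun A theta)^-1.
Proof.
move=> /star_set0 A0; apply: radial_star_body_of => eta _.
by rewrite inve_ge0 radial_ge0.
Qed.

End Facts.

Lemma convex_body_star_body (R : realType) (n : nat) (K : set 'rV[R]_n) :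
  convex_body K -> star_body K.
Proof.
move=> [cK vK K0].
have sK : star_set K.
  split; first by exists 0%R.
  move=> x l Kx /andP[l0 l1].
  have /(_ (Itv01 l0 l1)) := vK x 0%R _ (mem_set Kx) (mem_set K0).
  by move=> /set_mem; rewrite /conv/= scaler0 addr0.
split=> // theta st ry; have r0 := radial_ge0 theta K0.
have rf : radial_fun K theta \is a fin_num by rewrite ge0_fin_numE.
case: n K theta cK vK K0 sK st ry r0 rf => [|n] K theta cK vK K0 sK st ry r0 rf.
  by move: st; rewrite /sphere/= /dot big_ord0 => /eqP; rewrite eq_sym oner_eq0.
set r := fine _; set S := (fun l : R => (l *: theta)%R) @^-1` K.
have cS : closed S.
  apply: preimage_closed => // l _; exact: scalel_continuous.
suff : closure S r by move=> /cS.
move=> U /nbhs_ballP[e /= e0 eU].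
have : (r - e)%:E < radial_fun K theta.
  by rewrite -(fineK rf) lte_fin ltrBlDr ltrDl.
move=> /ereal_sup_gt[_ [m [m0 Km] <-]]; rewrite lte_fin => rem.
exists m; split => //; apply: eU; rewrite /ball/=.
have mr : (m <= r)%R.
  by rewrite -lee_fin fineK //; apply: ereal_sup_ubound; exists m.
by rewrite ger0_norm ?subr_ge0 // ltrBlDr -ltrBlDl.
Qed.

(* Main.v *)
Require Import Defs.
From mathcomp Require Import all_boot all_order all_algebra.
From mathcomp Require Import all_classical all_reals all_analysis.
From mathcomp Require Import ring lra.

(** For x in R^n, let B_x = {w : <w,w> <= <w,x>} be the ball with diameter
    [0,x] ([thales_ball]), and let the flower of T be the union of the B_x for
    x in T. Two elementary facts organize the proof.

    - B_x lies in the half-space {<.,y> <= 1} if and only if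
      <x,w><y,w> <= <w,w> for all w, a condition symmetric in x and y, which
      can also be written |x||y| + <x,y> <= 2 ([polar_thales_ballP],
      [polar_thales_ball_normP]). Consequently T' is the polar of the flower
      of T ([reciprocalE]), and T is contained in T''.
    - The radial function of Phi(K) is 1/r_K, which is the support function of
      the polar L of K. Hence Phi(K) is the flower of L, up to end points of
      radii ([Phi_flower], [sub_flower_Phi]).

    Suppose that L = T'. Then the flower of L is the union of all balls through
    0 that lie in the polar of T. A point of a segment between two such balls
    lies in a convex combination of them, which is a ball in the polar of T
    containing 0. A suitable homothetic image of this ball, centred at the
    point, contains a concentric ball through 0 and the point. So the flower of
    L is convex ([convex_flower_polar]), and Phi(K) is convex as well.

    Conversely, suppose that Phi(K) is convex. The claim is L = (L')', where
    only the inclusion of L'' in L needs proof. If y is in L'', separation shows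
    that B_y lies in the closure of Phi(K)
    ([thales_ball_sub_closure_flower]). If y were not in L, some p in K would
    have <p,y> > 1, so that the inversion p/<p,p> of p, and even a slightly
    longer multiple of p, would be interior to B_y, hence interior to the
    closure of Phi(K). An interior point of the closure of a convex set with
    non-empty interior belongs to the set ([convex_interior_closure]), but the
    ray through p leaves Phi(K) at p/<p,p> or earlier ([PhiP]), a
    contradiction. *)

Set Implicit Arguments.
Unset Strict Implicit.
Unset Printing Implicit Defensive.

Import Order.TTheory GRing.Theory Num.Theory.
Import numFieldNormedType.Exports.

Local Open Scope classical_set_scope.
Local Open Scope ring_scope.

(** * The Euclidean inner product and norm *)

Section InnerProduct.
Context {R : realType} {n : nat}.
Implicit Types (x y z : 'rV[R]_n) (a : R).

Lemma dotC x y : dot x y = dot y x.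
Proof. by apply: eq_bigr => i _; rewrite mulrC. Qed.

Lemma dotDl x y z : dot (x + y) z = dot x z + dot y z.
Proof. by rewrite /dot -big_split; apply: eq_bigr => i _; rewrite mxE mulrDl. Qed.

Lemma dotZl a x y : dot (a *: x) y = a * dot x y.
Proof. by rewrite -[y in LHS]scale1r dotZ mulr1. Qed.

Lemma dotDr x y z : dot z (x + y) = dot z x + dot z y.
Proof. by rewrite dotC dotDl !(dotC z). Qed.

Lemma dotZr a x y : dot x (a *: y) = a * dot x y.
Proof. by rewrite dotC dotZl dotC. Qed.

Lemma dotNl x y : dot (- x) y = - dot x y.
Proof. by rewrite -scaleN1r dotZl mulN1r. Qed.

Lemma dotNr x y : dot x (- y) = - dot x y.
Proof. by rewrite dotC dotNl dotC. Qed.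

Lemma dot0l x : dot 0 x = 0.
Proof. by rewrite -(scale0r 0) dotZl mul0r. Qed.

Lemma dot0r x : dot x 0 = 0.
Proof. by rewrite dotC dot0l. Qed.

Definition dotE := (dotDl, dotDr, dotZl, dotZr, dotNl, dotNr).

Lemma dot_ge0 x : 0 <= dot x x.
Proof. by apply: sumr_ge0 => i _; rewrite -expr2 sqr_ge0. Qed.

Definition enorm x : R := Num.sqrt (dot x x).

Lemma enorm_ge0 x : 0 <= enorm x.
Proof. exact: sqrtr_ge0. Qed.

Lemma sqr_enorm x : enorm x ^+ 2 = dot x x.
Proof. by rewrite sqr_sqrtr // dot_ge0. Qed.

Lemma enorm0 : enorm 0 = 0.
Proof. by rewrite /enorm dot0l sqrtr0. Qed.

Lemma enorm_gt0 x : x != 0 -> 0 < enorm x.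
Proof. by move=> x0; rewrite sqrtr_gt0 dot_gt0. Qed.

Lemma enorm_le x a : 0 <= a -> dot x x <= a ^+ 2 -> enorm x <= a.
Proof.
by move=> a0 xa; rewrite -(@ler_pXn2r _ 2) ?nnegrE ?enorm_ge0 // sqr_enorm.
Qed.

Lemma cauchy_schwarz x y : dot x y <= enorm x * enorm y.
Proof.
have [->|/enorm_gt0 x0] := eqVneq x 0; first by rewrite dot0l enorm0 mul0r.
have [->|/enorm_gt0 y0] := eqVneq y 0; first by rewrite dot0r enorm0 mulr0.
have := dot_ge0 (enorm y *: x - enorm x *: y).
rewrite !dotE -!sqr_enorm (dotC y x) => h.
have xy0 : 0 < enorm x * enorm y by rewrite mulr_gt0.
rewrite -subr_ge0 -(pmulr_rge0 _ xy0); nra.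
Qed.

Lemma enormD x y : enorm (x + y) <= enorm x + enorm y.
Proof.
apply: enorm_le; first by rewrite addr_ge0 // enorm_ge0.
have := cauchy_schwarz x y.
rewrite !dotE -!sqr_enorm (dotC y x); lra.
Qed.

Lemma enormZ a x : 0 <= a -> enorm (a *: x) = a * enorm x.
Proof.
by move=> a0; rewrite /enorm dotZ -expr2 sqrtrM ?sqr_ge0 // sqrtr_sqr ger0_norm.
Qed.

Lemma dot_continuous (T : topologicalType) (f g : T -> 'rV[R]_n) :
  continuous f -> continuous g -> continuous (fun t => dot (f t) (g t)).
Proof.
move=> cf cg; rewrite /dot.
apply: (@continuous_big R _ _ _ _ (@add_continuous R) T) => i _ t.
by apply: cvgM; [exact: (continuous_comp (cf t) (@coord_continuous _ _ _ _ i _))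
  | exact: (continuous_comp (cg t) (@coord_continuous _ _ _ _ i _))].
Qed.

End InnerProduct.

(** * Closures of convex sets *)

Lemma convex_setP (R : numDomainType) (W : lmodType R) (A : set W) :
  convex_set (A : set (convex_lmodType W)) <->
  forall x y (t : R), A x -> A y -> 0 <= t <= 1 -> A (t *: x + (1 - t) *: y).
Proof.
split=> [cA x y t Ax Ay /andP[t0 t1]|cA x y l /set_mem Ax /set_mem Ay].
  have := cA x y (Itv01 t0 t1) (mem_set Ax) (mem_set Ay).
  by move=> /set_mem; rewrite /conv/=.
apply/mem_set; rewrite /conv/=; apply: cA => //; apply/andP; split => //.
Qed.

Section ConvexSets.
Context {R : realType} {V : normedModType R}.
Implicit Types (C : set V) (x y : V).

Lemma closure_ballP C x :
  closure C x <-> forall e : R, 0 < e -> exists2 y, C y & `|x - y| < e.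
Proof.
split=> [cx e e0|h U /nbhs_ballP[e /= e0 eU]].
  have [y [Cy]] := cx _ (nbhsx_ballx x e e0).
  by rewrite -ball_normE => xy; exists y.
have [y Cy xy] := h _ e0; exists y; split=> //; apply: eU.
by rewrite -ball_normE.
Qed.

Lemma convex_closure C : convex_set (C : set (convex_lmodType V)) ->
  convex_set (closure C : set (convex_lmodType V)).
Proof.
move=> /convex_setP cC; apply/convex_setP => x y t.
move=> /closure_ballP xC /closure_ballP yC.
move=> /[dup] t01 /andP[t0 t1]; apply/closure_ballP => e e0.
have [x' Cx' xx'] := xC _ e0; have [y' Cy' yy'] := yC _ e0.
exists (t *: x' + (1 - t) *: y'); first exact: cC.
have -> : t *: x + (1 - t) *: y - (t *: x' + (1 - t) *: y') =
    t *: (x - x') + (1 - t) *: (y - y').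
  by rewrite !scalerBr opprD addrACA.
apply: le_lt_trans (ler_normD _ _) _.
rewrite !normrZ !ger0_norm ?subr_ge0 //.
have [->|tn0] := eqVneq t 0; first by rewrite mul0r add0r subr0 mul1r.
have tp : 0 < t by rewrite lt_def tn0.
nra.
Qed.

(** Given z interior to the closure and b interior to C, prolong the segment
    from b to z slightly beyond z, to a point u of the closure, and replace u by
    a nearby v in C. The other end of the segment through z starting at v is
    close to b, hence in C. *)
Lemma convex_interior_closure C : convex_set (C : set (convex_lmodType V)) ->
  interior C !=set0 -> interior (closure C) `<=` C.
Proof.
move=> /convex_setP cC [b /nbhs_ballP[r /= r0 rC]] z /nbhs_ballP[e /= e0 ez].
pose d := e / (1 + `|z - b|) / 2.
have nz : 0 < 1 + `|z - b| by rewrite ltr_pwDl.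
have d0 : 0 < d by rewrite !divr_gt0.
have /closure_ballP/(_ (d * r)) : closure C (z + d *: (z - b)).
  apply: ez; rewrite -ball_normE /ball_ /= opprD addrA subrr sub0r.
  rewrite normrN normrZ gtr0_norm //.
  have : d * (1 + `|z - b|) = e / 2 by rewrite /d; field; rewrite lt0r_neq0.
  lra.
case=> [|v Cv]; first exact: mulr_gt0.
set u := z + d *: (z - b) => uv.
have Cb : C (b + d^-1 *: (u - v)).
  apply: rC; rewrite -ball_normE /ball_ /= opprD addrA subrr sub0r.
  by rewrite normrN normrZ gtr0_norm ?invr_gt0 // ltr_pdivrMl.
have d1 : 0 < 1 + d by rewrite addr_gt0.
have := cC _ _ (1 + d)^-1 Cv Cb.
have -> : 1 - (1 + d)^-1 = (1 + d)^-1 * d by field; rewrite lt0r_neq0.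
have db : d *: (b + d^-1 *: (u - v)) = d *: b + u - v.
  by rewrite scalerDr scalerA divff ?lt0r_neq0 // scale1r addrA.
rewrite -scalerA -scalerDr db [v + _]addrC subrK /u addrCA -scalerDr subrKC.
rewrite -{1}[z]scale1r -scalerDl scalerA mulVf ?lt0r_neq0 // scale1r; apply.
by rewrite invr_ge0 ltW //= invf_le1 // lerDl ltW.
Qed.

End ConvexSets.

(** * Separation and the bipolar theorem *)

Section Polarity.
Context {R : realType} {n : nat}.
Implicit Types (A C : set 'rV[R]_n) (x y z w : 'rV[R]_n).

Lemma dot_continuousl y : continuous (fun x : 'rV[R]_n => dot x y).
Proof.
by apply: dot_continuous; [move=> x; exact: cvg_id | exact: cst_continuous].
Qed.

Lemma closed_halfspace y (a : R) : closed [set x : 'rV[R]_n | dot x y <= a].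
Proof.
rewrite (_ : mkset _ = (fun x => dot x y) @^-1` [set b | b <= a]) //.
apply: preimage_closed (@closed_le _ a) => x _.
exact: dot_continuousl.
Qed.

Lemma convex_body_polar A : convex_body (polar A).
Proof.
split.
- rewrite (_ : polar A = \bigcap_(x in A) [set y | dot y x <= 1]).
    by apply: closed_bigI => x _; exact: closed_halfspace.
  by apply/seteqP; split=> y yA x /yA; rewrite /= dotC.
- apply/convex_setP => y z t yA zA /andP[t0 t1] x Ax.
  rewrite !dotE; have := yA x Ax; have := zA x Ax; nra.
- by move=> x _; rewrite dot0r.
Qed.

Lemma le0_of_le_scale (a b : R) :
  (forall t, 0 < t <= 1 -> a <= t * b) -> a <= 0.
Proof.
move=> h; rewrite leNgt; apply/negP => a0.
have b0 : 0 < b by have := h 1; rewrite ltr01 lexx mul1r => /(_ isT); lra.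
have ab : a <= b by have := h 1; rewrite ltr01 lexx mul1r => /(_ isT).
have b0' := lt0r_neq0 b0.
have := h (a / (2 * b)).
rewrite divr_gt0 ?mulr_gt0 //= ler_pdivrMr ?mulr_gt0 // mul1r.
have -> : a / (2 * b) * b = a / 2 by field.
by move=> /(_ ltac:(lra)); lra.
Qed.

(** The search is restricted to the points no farther from w than 0 is, which
    form a compact set. *)
Lemma nearest_point C w : closed C -> C 0 ->
  exists2 c, C c & forall x, C x -> dot (w - c) (w - c) <= dot (w - x) (w - x).
Proof.
move=> cC C0.
pose f (x : 'rV[R]_n) := dot (w - x) (w - x).
have cf : continuous f.
  have cw : continuous (fun x : 'rV[R]_n => w - x).
    by move=> x; apply: continuousB; [exact: (@cst_continuous _ _ w) | exact: cvg_id].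
  exact: dot_continuous.
pose A := C `&` [set x | f x <= f 0].
have cA : compact A.
  apply: bounded_closed_compact; last first.
    apply: closedI => //.
    rewrite (_ : mkset _ = f @^-1` [set b | b <= f 0]) //.
    by apply: preimage_closed (@closed_le _ _) => x _; exact: cf.
  exists (`|w| + (f 0 + 1)); split; first exact: num_real.
  move=> M ltM x [_ fx]; apply: le_trans (ltW ltM).
  rewrite -[x](subKr w); apply: le_trans (ler_normB _ _) _; rewrite lerD2l.
  rewrite [leLHS]/Num.norm /= mx_normrE; apply/bigmax_leP => /=.
  split=> [|[i j] _]; first by rewrite addr_ge0 // dot_ge0.
  rewrite !mxE /= (ord1 i).
  have : (w ord0 j - x ord0 j) ^+ 2 <= f 0.
    apply: le_trans fx; rewrite /f /dot (bigD1 j) //= !mxE -expr2 lerDl.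
    by apply: sumr_ge0 => k _; rewrite -expr2 sqr_ge0.
  rewrite -real_normK ?num_real //.
  by move: `| _ | (normr_ge0 (w ord0 j - x ord0 j)) => a; nra.
have A0 : A 0 by split => //=.
have [|c /set_mem[Cc _] cmin] :=
  EVT_min_rV (ex_intro _ 0 A0) cA (f := f).
  exact: continuous_subspaceT.
exists c => // x Cx; have [fx|/ltW fx] := leP (f x) (f 0).
  by apply: cmin; apply/mem_set; split.
by apply: le_trans fx; apply: cmin; exact/mem_set.
Qed.

(** The separating direction is u = w - c for c the point of the closure nearest
    to w: minimality along the segment from c to x gives <x,u> <= <c,u>, while
    <w,u> = <c,u> + <u,u>. *)
Lemma polar_separation C w : convex_set (C : set (convex_lmodType 'rV[R]_n)) ->
  C 0 -> ~ closure C w -> exists2 y, polar C y & 1 < dot w y.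
Proof.
move=> cC C0 nw.
have [c Dc cmin] := nearest_point w (@closed_closure _ C) (subset_closure C0).
have [u wE] : exists u, w = u + c by exists (w - c); rewrite subrK.
rewrite {}wE {w} in nw cmin *; rewrite addrK in cmin.
have u0 : 0 < dot u u.
  by apply: dot_gt0; apply/eqP => u0; apply: nw; rewrite u0 add0r.
have variational x : closure C x -> dot x u <= dot c u.
  move=> Dx; rewrite -subr_le0 -(pmulr_rle0 _ (@ltr0n R 2)).
  apply: (@le0_of_le_scale _ (dot (x - c) (x - c))) => t /andP[t0 t1].
  have t01 : 0 <= t <= 1 by rewrite t1 ltW.
  have := cmin _ ((convex_setP _).1 (convex_closure cC) _ _ t Dx Dc t01).
  have -> : u + c - (t *: x + (1 - t) *: c) = u - t *: (x - c).
    by apply/rowP => i; rewrite !mxE; ring.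
  rewrite -subr_ge0 => h; rewrite -(ler_pM2l t0) -subr_ge0.
  move: h; rewrite !dotE !(dotC u) (dotC c x); lra.
have c0 : 0 <= dot c u.
  by rewrite -(dot0l u); apply: variational; exact: subset_closure.
(* Any level strictly between <c,u> >= 0 and <w,u> can be normalized to 1. *)
pose g := dot c u + dot u u / 2.
have g0 : 0 < g by rewrite /g; lra.
exists (g^-1 *: u) => [x Cx|].
  rewrite dotZr ler_pdivrMl // mulr1.
  by have := variational _ (subset_closure Cx); rewrite /g; lra.
rewrite dotZr ltr_pdivlMl // mulr1 dotDl /g; lra.
Qed.

Lemma bipolar C w : convex_body C -> polar (polar C) w -> C w.
Proof.
move=> [cC vC C0] ppw; apply: contrapT => nCw.
have [|y py] := polar_separation vC C0 (w := w).
  by rewrite closure_id in cC; rewrite -cC.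
by rewrite ltNge dotC ppw.
Qed.

End Polarity.

(** * Balls through the origin and flowers *)

Section Flowers.
Context {R : realType} {n : nat}.
Implicit Types (K L T : set 'rV[R]_n) (x y z w q : 'rV[R]_n).

(** By Thales' theorem, the points seeing [0,x] under an angle of at least
    90 degrees. *)
Definition thales_ball x : set 'rV[R]_n := [set w | dot w w <= dot w x].

Definition flower T : set 'rV[R]_n := \bigcup_(x in T) thales_ball x.

(** In direction w the farthest point of the ball is the projection
    (<w,x>/<w,w>) w of x. *)
Lemma polar_thales_ballP x y :
  polar (thales_ball x) y <-> forall w, dot w x * dot w y <= dot w w.
Proof.
split=> [h w|h w xw].
  have [->|/dot_gt0 w0] := eqVneq w 0; first by rewrite !dot0l mul0r.
  have /h : thales_ball x ((dot w x / dot w w) *: w).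
    by rewrite /thales_ball /= dotZ dotZl -mulrA divfK ?lt0r_neq0.
  by rewrite dotZl mulrAC ler_pdivrMr // mul1r.
have [->|/dot_gt0 w0] := eqVneq w 0; first by rewrite dot0l.
have [yw|yw] := leP (dot w y) 0; first exact: le_trans yw ler01.
rewrite -(ler_pM2l w0) mulr1; apply: le_trans (h w).
by rewrite ler_pM2r.
Qed.

Lemma polar_thales_ball_sym x y :
  polar (thales_ball x) y -> polar (thales_ball y) x.
Proof.
by move=> /polar_thales_ballP h; apply/polar_thales_ballP => w; rewrite mulrC.
Qed.

(** The ball has centre x/2 and radius |x|/2. *)
Lemma thales_ball_norm x w : thales_ball x w -> enorm (2 *: w - x) <= enorm x.
Proof.
rewrite /thales_ball /= => xw; apply: enorm_le (enorm_ge0 _) _.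
rewrite sqr_enorm !dotE (dotC x w); lra.
Qed.

(** The maximum of <.,y> over the ball with centre x/2 and radius |x|/2 is
    (<x,y> + |x||y|)/2. *)
Lemma polar_thales_ball_normP x y :
  polar (thales_ball x) y <-> enorm x * enorm y + dot x y <= 2.
Proof.
split=> [/polar_thales_ballP h|h w].
  have [->|/enorm_gt0 x0] := eqVneq x 0; first by rewrite enorm0 dot0l; lra.
  have [->|/enorm_gt0 y0] := eqVneq y 0; first by rewrite enorm0 dot0r; lra.
  (* The product of the two projections is largest along the bisector. *)
  have := h (enorm y *: x + enorm x *: y).
  rewrite !dotE -!sqr_enorm (dotC y x).
  have xy0 : 0 < enorm x * enorm y by rewrite mulr_gt0.
  move=> e; rewrite leNgt; apply/negP => h2.
  have : 0 < enorm x * enorm y * (enorm x * enorm y + dot x y) *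
      (enorm x * enorm y + dot x y - 2) by rewrite !mulr_gt0 //; lra.
  move: e; lra.
have := cauchy_schwarz y (2 *: w - x).
move=> + /thales_ball_norm /(ler_wpM2l (enorm_ge0 y)).
rewrite !dotE (dotC y w) (dotC y x); lra.
Qed.

Lemma polar_flower T y :
  polar (flower T) y <-> forall x, T x -> polar (thales_ball x) y.
Proof.
by split=> [h x Tx w xw|h w [x Tx xw]]; [apply: h; exists x | exact: h xw].
Qed.

(** * Reciprocal bodies and Phi in terms of flowers *)

(** For a unit vector theta, the inequality <y,theta> <= 1/h_T(theta) says that
    <x,theta><y,theta> <= 1 for all x in T as soon as <y,theta> > 0; this sign
    condition disappears because the product is even in theta. *)
Lemma reciprocalE T : T 0 -> reciprocal T = polar (flower T).
Proof.
move=> T0.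
have g0 theta : (0 <= support_fun T theta)%E.
  by apply: ereal_sup_ubound; exists 0 => //; rewrite dot0l.
have wulffP y theta : ((dot y theta)%:E <= (support_fun T theta)^-1)%E <->
    forall x, T x -> 0 < dot theta y -> dot theta x * dot theta y <= 1.
  rewrite !(dotC theta); have [y0|y0] := leP (dot y theta) 0.
    split=> // _; apply: (@le_trans _ _ 0%E); first by rewrite lee_fin.
    by rewrite inve_ge0.
  rewrite inve_pge ?inE ?lee_fin ?(ltW y0) // inver gt_eqF //.
  split=> [h x Tx _|h].
    have : ((dot x theta)%:E <= (dot y theta)^-1%:E)%E.
      by apply: le_trans h; apply: ereal_sup_ubound; exists x.
    by rewrite lee_fin -[_^-1]mul1r ler_pdivlMr // (dotC theta).
  apply: ge_ereal_sup => _ [x Tx <-]; rewrite lee_fin -[_^-1]mul1r.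
  by rewrite ler_pdivlMr // (dotC x) h.
apply/seteqP; split=> y.
  move=> hy; apply/polar_flower => x Tx; apply/polar_thales_ballP => w.
  have [->|] := eqVneq w 0; first by rewrite !dot0l mul0r.
  move=> /polar_decomposition[theta [l [st l0 ->]]].
  have /wulffP/(_ x Tx) := hy _ st.
  have /wulffP/(_ x Tx) : ((dot y (- theta))%:E <= (support_fun T (- theta))^-1)%E.
    by apply: hy; rewrite /sphere /= dotNl dotNr opprK.
  rewrite !dotE st mulrNN => hN hP; rewrite mulr1 mulrACA.
  rewrite ler_piMr ?mulr_ge0 ?(ltW l0) //.
  have [y0|y0|->] := ltgtP (dot theta y) 0; last by rewrite mulr0.
    by apply: hN; rewrite oppr_gt0.
  exact: hP.
move=> /polar_flower hy theta st; apply/wulffP => x Tx _.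
by have /polar_thales_ballP/(_ theta) := hy _ Tx; rewrite st.
Qed.

(** On the ray of a unit vector, l theta is in Phi(K) if and only if l m <= 1
    for each m theta in K; the formula below is homogeneous, so that it avoids
    the normalization. *)
Lemma PhiP K q : K 0 ->
  Phi K q <-> forall m, 0 <= m -> K (m *: q) -> m * dot q q <= 1.
Proof.
move=> K0; have [->|] := eqVneq q 0.
  by split=> _; [move=> m; rewrite dot0l mulr0 | left].
move=> /polar_decomposition[theta [l [st l0 ->]]].
have g0 eta : sphere R n eta -> (0 <= (radial_fun K eta)^-1)%E.
  by move=> _; rewrite inve_ge0 radial_ge0.
apply: iff_trans (star_body_ofE g0 st (ltW l0)) _.
rewrite inve_pge ?inE ?radial_ge0 ?lee_fin ?(ltW l0) //.
rewrite inver gt_eqF // dotZ st mulr1; split=> [h m m0 Km|h].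
  have : ((m * l)%:E <= l^-1%:E)%E.
    apply: le_trans h; apply: ereal_sup_ubound; exists (m * l) => //; split.
      by rewrite mulr_ge0 ?(ltW l0).
    by rewrite -scalerA.
  by rewrite lee_fin -[l^-1]mul1r ler_pdivlMr // mulrA.
apply: ge_ereal_sup => _ [m [m0 Km] <-]; rewrite lee_fin.
have := h (m / l); rewrite divr_ge0 ?(ltW l0) // scalerA divfK ?gt_eqF //.
move=> /(_ isT Km); rewrite mulrA divfK ?gt_eqF // => ml.
by rewrite -[l^-1]mul1r ler_pdivlMr.
Qed.

(** Let z = t z1 + (1-t) z2 with zi in the ball of yi. The ball with centre
    y0/2 and radius N/2, where N = t|y1| + (1-t)|y2|, is the corresponding
    combination of the two balls: it contains z and 0, and it satisfies the same
    linear inequalities. Its image under the homothety with centre z and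
    ratio s in [0,1] contains z and lies in it, and the concentric ball with
    diameter [0, 2(1-s)z + s y0] lies in this image, for a suitable s. *)
Lemma convex_flower_polar T :
  convex_set (flower (polar (flower T)) : set (convex_lmodType 'rV[R]_n)).
Proof.
apply/convex_setP => z1 z2 t.
move=> [y1 /polar_flower Ly1 z1y1] [y2 /polar_flower Ly2 z2y2].
move=> /andP[t0 t1].
set z := t *: z1 + (1 - t) *: z2.
pose y0 := t *: y1 + (1 - t) *: y2.
pose N := t * enorm y1 + (1 - t) * enorm y2.
have t1' : 0 <= 1 - t by rewrite subr_ge0.
have N0 : 0 <= N by rewrite addr_ge0 // mulr_ge0 // enorm_ge0.
have y0N : enorm y0 <= N.
  by apply: le_trans (enormD _ _) _; rewrite !enormZ.
have zN : enorm (2 *: z - y0) <= N.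
  have -> : 2 *: z - y0 = t *: (2 *: z1 - y1) + (1 - t) *: (2 *: z2 - y2).
    by apply/rowP => i; rewrite !mxE; ring.
  apply: le_trans (enormD _ _) _; rewrite !enormZ //.
  by apply: lerD; apply: ler_wpM2l => //; exact: thales_ball_norm.
have TN x : T x -> enorm x * N + dot x y0 <= 2.
  move=> Tx; have /polar_thales_ball_normP h1 := Ly1 _ Tx.
  have /polar_thales_ball_normP h2 := Ly2 _ Tx.
  rewrite /N !dotE; nra.
have Tz x : T x -> dot x z <= 1.
  move=> Tx; have := polar_thales_ball_sym (Ly1 _ Tx) z1y1.
  have := polar_thales_ball_sym (Ly2 _ Tx) z2y2.
  rewrite !dotE !(dotC x); nra.
clearbody z y0 N.
have [zy0|zy0] := leP (dot z z) (dot z y0).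
  exists y0 => //; apply/polar_flower => x Tx; apply/polar_thales_ball_normP.
  apply: le_trans (TN _ Tx); rewrite lerD2r.
  by rewrite ler_wpM2l // enorm_ge0.
(* The ratio s makes z itself a boundary point of the ball with diameter
   [0, 2(1-s)z + s y0]. *)
have d0 : 0 < 2 * dot z z - dot z y0 by have := dot_ge0 z; lra.
pose s := dot z z / (2 * dot z z - dot z y0).
have s0 : 0 <= s by rewrite divr_ge0 ?dot_ge0 // ltW.
have s1 : s <= 1 by rewrite ler_pdivrMr //; lra.
have sE : s * (2 * dot z z - dot z y0) = dot z z by rewrite divfK // lt0r_neq0.
clearbody s.
exists ((2 * (1 - s)) *: z + s *: y0); last first.
  by rewrite /thales_ball /= !dotE -{1}sE; lra.
have yN : enorm ((2 * (1 - s)) *: z + s *: y0) <= s * N.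
  apply: enorm_le; first exact: mulr_ge0.
  have : enorm (2 *: z - y0) ^+ 2 <= N ^+ 2.
    by rewrite ler_pXn2r // nnegrE enorm_ge0.
  rewrite sqr_enorm !dotE (dotC y0 z) => h.
  have := ler_wpM2l (sqr_ge0 s) h.
  move: (dot z y0) (dot y0 y0) (dot z z) sE => e f g sE.
  have : s * g = s * (s * (2 * g - e)) by rewrite sE.
  lra.
apply/polar_flower => x Tx; apply/polar_thales_ball_normP.
have := TN x Tx; have := Tz x Tx; have := ler_wpM2l (enorm_ge0 x) yN.
rewrite !dotE; nra.
Qed.

(** If s q avoids the ball of each y in the polar of K, then
    <q,y> < s <q,q> for all these y; so q / (s <q,q>) is in K by the bipolar
    theorem, which puts q outside Phi(K). The factor s < 1 is needed because the
    support function of the polar need not be attained. *)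
Lemma Phi_flower K q : convex_body K ->
  Phi K q <-> forall s, 0 <= s < 1 -> flower (polar K) (s *: q).
Proof.
move=> bK; have [_ _ K0] := bK.
apply: iff_trans (PhiP q K0) _; split=> [hq s /andP[s0 s1]|hq m m0 Km].
  apply: contrapT => nU.
  have {}nU y : polar K y -> s * dot q y < s ^+ 2 * dot q q.
    move=> Ly; rewrite ltNge; apply/negP => yU; apply: nU; exists y => //.
    by rewrite /thales_ball /= !dotE mulrA -expr2.
  have sq : 0 < s ^+ 2 * dot q q.
    have := nU 0; rewrite dot0r mulr0; apply=> x _; rewrite dot0r; exact: ler01.
  have s0' : 0 < s.
    by rewrite lt_def s0 andbT; apply/eqP => sz; move: sq; rewrite sz; lra.
  have q0 : 0 < dot q q by move: sq; rewrite pmulr_rgt0 // exprn_gt0.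
  have Kp : K ((s * dot q q)^-1 *: q).
    apply: bipolar => // y Ly; rewrite dotC dotZl ler_pdivrMl ?mulr_gt0 // mulr1.
    by rewrite ltW // -(ltr_pM2l s0') mulrA -expr2 nU.
  have := hq _ _ Kp; rewrite invr_ge0 mulr_ge0 ?(ltW q0) // => /(_ isT).
  by rewrite invfM -mulrA mulVf ?lt0r_neq0 // mulr1 invf_le1 // leNgt s1.
rewrite leNgt; apply/negP => mq.
have mq0 : 0 < m * dot q q := lt_trans ltr01 mq.
(* A number strictly between 1 / (m <q,q>) and 1. *)
pose s := (1 + (m * dot q q)^-1) / 2.
have smq : s * (m * dot q q) = (m * dot q q + 1) / 2.
  by rewrite /s mulrAC mulrDl mul1r mulVf ?lt0r_neq0.
have i0 : 0 < (m * dot q q)^-1 by rewrite invr_gt0.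
have i1 : (m * dot q q)^-1 < 1 by rewrite invf_lt1.
have s0 : 0 < s by rewrite /s; lra.
have [|y Ly] := hq s; first by rewrite ltW //= /s; lra.
rewrite /thales_ball /= dotZ dotZl -mulrA ler_pM2l // => qy.
have := Ly _ Km; rewrite dotZl => my.
have := ler_wpM2l m0 qy; lra.
Qed.

(** * The two implications *)

Lemma interior_thales_ball x w : dot w w < dot w x -> interior (thales_ball x) w.
Proof.
move=> wx.
pose f (v : 'rV[R]_n) := dot v x - dot v v.
have cf : continuous f.
  have cv : continuous (fun v : 'rV[R]_n => dot v v).
    by apply: dot_continuous => u; exact: cvg_id.
  by move=> v; exact: cvgB (@dot_continuousl _ _ x v) (cv v).
have fw : 0 < f w by rewrite subr_gt0.
have := @cvgr_gt _ _ _ _ f (f w) (cf w) _ fw; rewrite /interior.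
by move=> /(_ _); apply: filterS => v; rewrite subr_gt0 => /ltW.
Qed.

Lemma sub_flower_Phi K : K 0 -> flower (polar K) `<=` Phi K.
Proof.
move=> K0 q [y Ly qy]; apply/PhiP => // m m0 Km.
have := Ly _ Km; rewrite dotZl; apply: le_trans.
exact: ler_wpM2l.
Qed.

Lemma sub_reciprocal_reciprocal T :
  T `<=` polar (flower (polar (flower T))).
Proof.
move=> y Ty; apply/polar_flower => x /polar_flower/(_ y Ty).
exact: polar_thales_ball_sym.
Qed.

(** A half-space {<.,x> <= 1} containing C contains the flower of T, so x is in
    T', and by symmetry the half-space contains the ball of each y in T''. *)
Lemma thales_ball_sub_closure_flower C T y :
  convex_set (C : set (convex_lmodType 'rV[R]_n)) -> C 0 -> flower T `<=` C ->
  polar (flower (polar (flower T))) y -> thales_ball y `<=` closure C.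
Proof.
move=> vC C0 TC /polar_flower yTT w yw; apply: contrapT.
move=> /(polar_separation vC C0)[x Cx]; rewrite ltNge => /negP; apply.
have /yTT/polar_thales_ball_sym : polar (flower T) x by move=> v /TC/Cx.
exact.
Qed.

(** This is where convexity of Phi(K) enters: it makes Phi(K) absorb the interior
    of its closure. The degenerate case in which the polar of K is {0}, so that
    Phi(K) may have empty interior, is treated separately. *)
Lemma reciprocal_reciprocal_polar K : convex_body K ->
  convex_set (Phi K : set (convex_lmodType 'rV[R]_n)) ->
  polar (flower (polar (flower (polar K)))) `<=` polar K.
Proof.
move=> [_ _ K0] vPhi y LLy p Kp; rewrite leNgt; apply/negP => py.
have Phi0 : Phi K 0 by left.
have ballPhi := thales_ball_sub_closure_flower vPhi Phi0 (sub_flower_Phi K0) LLy.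
have y0 : 0 < dot y y.
  by apply: dot_gt0; apply/eqP => y0; move: py; rewrite y0 dot0r; lra.
have [L0|] := pselect (polar K `<=` [set 0]).
  (* Here every vector is in L', and testing y against 2 y / <y,y> forces
     y = 0. *)
  have /polar_flower/(_ ((2 / dot y y) *: y)) := LLy.
  have all_recip x : polar (flower (polar K)) x.
    apply/polar_flower => _ /L0 ->; apply/polar_thales_ball_normP.
    by rewrite enorm0 dot0l; lra.
  move=> /(_ (all_recip _))/polar_thales_ballP/(_ y).
  by rewrite dotZr divfK ?lt0r_neq0 //; lra.
move=> /existsNP[y1 /not_implyP[Ly1 y1n0]].
have intPhi : interior (Phi K) !=set0.
  exists (2^-1 *: y1).
  apply: (@interiorS _ _ _ _ _ (interior_thales_ball (x := y1) _)).
    by move=> w wy; apply: sub_flower_Phi => //; exists y1.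
  rewrite dotZ dotZl; have /dot_gt0 : y1 != 0 by exact/eqP.
  lra.
have p0 : 0 < dot p p.
  by apply: dot_gt0; apply/eqP => p0; move: py; rewrite p0 dot0l; lra.
(* The point c p lies strictly between p / <p,p> and the boundary point
   (<p,y> / <p,p>) p of the ball of y. *)
pose c := (1 + dot p y) / 2 / dot p p.
have cp : c * dot p p = (1 + dot p y) / 2 by rewrite divfK ?lt0r_neq0.
have c0 : 0 < c by rewrite divr_gt0 //; lra.
have : Phi K (c *: p).
  apply: (convex_interior_closure vPhi intPhi).
  apply: (interiorS ballPhi); apply: interior_thales_ball.
  by rewrite dotZ dotZl -mulrA cp ltr_pM2l //; lra.
move=> /PhiP -/(_ K0 c^-1); rewrite invr_ge0 (ltW c0) scalerA mulVf ?lt0r_neq0 //.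
rewrite scale1r => /(_ isT Kp); rewrite dotZ -mulrA mulKf ?lt0r_neq0 // cp; lra.
Qed.

End Flowers.

Theorem theorem13 (R : realType) (n : nat) (K : set 'rV[R]_n)
    (hK : convex_body K) :
  convex_set (Phi K : set (convex_lmodType 'rV[R]_n)) <->
  reciprocal_bodies R n (polar K).
Proof.
have bL := convex_body_polar K; have [_ _ L0] := bL.
split=> [vPhi|[T [_ _ T0] TL]].
  have bL' := convex_body_polar (flower (polar K)); have [_ _ L'0] := bL'.
  exists (reciprocal (polar K)); rewrite reciprocalE // reciprocalE //.
  apply/seteqP; split; last exact: sub_reciprocal_reciprocal.
  exact: reciprocal_reciprocal_polar.
have vU : convex_set (flower (polar K) : set (convex_lmodType 'rV[R]_n)).
  by rewrite -TL reciprocalE //; exact: convex_flower_polar.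
apply/convex_setP => q1 q2 t /(Phi_flower _ hK) h1 /(Phi_flower _ hK) h2 t01.
apply/(Phi_flower _ hK) => s s01.
rewrite scalerDr !scalerA !(mulrC s) -!scalerA.
by apply: (convex_setP _).1 => //; [exact: h1 | exact: h2].
Qed.
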